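(* Let $\mu$ be a non-atomic homogeneously multifractal (HM) measure supported on $[0,1]$. Then there exists $\alpha$ with $0\le \alpha\le 1$ such that $\mathrm{Support}(d_\mu)\cap[0,1]=[\alpha,1]$.
   Context: Measures are finite positive Borel measures; $\mathrm{Supp}(\mu)$ is the smallest closed set whose complement has $\mu$-measure $0$. For $x_0\in \mathrm{Supp}(\mu)$ the (lower) local dimension is $$h_\mu(x_0)=\liminf_{r\to0^+}\frac{\log\mu(B(x_0,r))}{\log r},$$ where $B(x_0,r)$ is the open ball with center $x_0$ and radius $r$; for $x_0\notin \mathrm{Supp}(\mu)$ one sets $h_\mu(x_0)=+\infty$. Let $\dim$ denote Hausdorff dimension with the convention $\dim\emptyset=-\infty$. The multifractal spectrum of a measure $\mu$ supported in $[0,1]$ is $d_\mu(h)=\dim\{x\in[0,1]:h_\mu(x)=h\}$ for $h\ge0$, and $\mathrm{Support}(d_\mu)=\{h\ge0: d_\mu(h)\ge0\}$ (i.e. the set of $h\geq 0$ taken as a value by $h_\mu$). A measure $\mu$ supported in $[0,1]$ is homogeneously multifractal (HM) if for every non-degenerate subinterval $U\subset[0,1]$ and every $h\ge0$, $\dim\{x\in U:h_\mu(x)=h\}=\dim\{x\in[0,1]:h_\mu(x)=h\}=d_\mu(h)$. *)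

(* Defs.v *)
From HB Require Import structures.
From mathcomp Require Import all_boot all_order all_algebra.
From mathcomp Require Import all_classical all_reals all_analysis.

Set Implicit Arguments.
Unset Strict Implicit.
Unset Printing Implicit Defensive.

Import Order.TTheory GRing.Theory Num.Theory.
Import numFieldNormedType.Exports.

Local Open Scope classical_set_scope.
Local Open Scope ring_scope.

Section HausdorffDimension.
Variable R : realType.
Implicit Types (U A : set R) (s delta : R).

(* ediam set0 = -oo *)
Definition ediam U : \bar R :=
  ereal_sup [set z | exists x y, [/\ U x, U y & z = `|x - y|%:E]].

(* The value at set0 is 0 for every s, including s = 0; since poweR 0 0 = 1,
   a nonempty set of diameter 0 has gauge 1 when s = 0, so that
   hausdorff_measure 0 is the counting measure. *)
Definition hausdorff_gauge s U : \bar R :=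
  if U == set0 then 0%E else poweR (ediam U) s.

(* Covers are indexed by nat; finite covers are padded with set0. *)
Definition hausdorff_premeasure s delta A : \bar R :=
  ereal_inf [set z | exists U_ : nat -> set R,
    [/\ A `<=` \bigcup_i U_ i,
        forall i, (ediam (U_ i) <= delta%:E)%E &
        z = (\sum_(0 <= i <oo) hausdorff_gauge s (U_ i))%E]].

Definition hausdorff_measure s A : \bar R :=
  ereal_sup [set hausdorff_premeasure s delta A | delta in [set d : R | 0 < d]].

Definition hausdorff_dim A : \bar R :=
  if A == set0 then -oo%E
  else ereal_inf [set s%:E | s in
         [set s : R | 0 <= s /\ hausdorff_measure s A = 0%E]].

End HausdorffDimension.

Section Multifractal.
Variable R : realType.
Implicit Types (mu : {finite_measure set (measurableTypeR R) -> \bar R}).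

Definition supp mu : set R :=
  \bigcap_(F in [set F : set R | closed F /\ mu (~` F) = 0%E]) F.

(* In the first branch every ball around x has positive finite measure, so
   neither fine nor ln is applied outside its meaningful domain. *)
Definition local_dim mu (x : R) : \bar R :=
  if x \in supp mu then
    limf_einf (fun r : R => (ln (fine (mu (ball x r))) / ln r)%:E) 0^'+
  else +oo%E.

Definition level_set mu (h : R) : set R := [set x | local_dim mu x = h%:E].

Definition spectrum mu (h : R) : \bar R :=
  hausdorff_dim (`[0, 1] `&` level_set mu h).

Definition spectrum_support mu : set R :=
  [set h : R | 0 <= h /\ (0 <= spectrum mu h)%E].

Definition nondegenerate_interval (U : set R) : Prop :=
  is_interval U /\ exists x y, [/\ U x, U y & x < y].

Definition homogeneously_multifractal mu : Prop :=
  supp mu `<=` `[0, 1] /\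
  forall U : set R, nondegenerate_interval U -> U `<=` `[0, 1] ->
  forall h : R, 0 <= h -> hausdorff_dim (U `&` level_set mu h) = spectrum mu h.

Definition non_atomic mu : Prop := forall x : R, mu [set x] = 0%E.

End Multifractal.

(* Main.v *)
Require Import Defs.
From mathcomp Require Import all_boot all_order all_algebra.
From mathcomp Require Import all_classical all_reals all_analysis.
From mathcomp Require Import measurable_realfun lra ring.
Import Order.TTheory GRing.Theory Num.Theory.
Import numFieldNormedType.Exports.
Local Open Scope classical_set_scope.
Local Open Scope ring_scope.

Set Implicit Arguments.
Unset Strict Implicit.
Unset Printing Implicit Defensive.

(** By homogeneity, a value of the local dimension attained at one point is
attained in every nondegenerate subinterval of [0, 1]
([homogeneous_values_dense]), so everything reduces to the set V of values.
Let a be its infimum. The claim is that a <= 1, that a is attained, and that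
every b with a < b <= 1 is attained.

If the local dimension exceeded 1 everywhere, every point would have small
balls whose mass is at most t times their length, for any given t > 0; by a
Vitali covering the whole measure would then vanish
([exists_local_dim_le1]). So a <= 1.

The points that have arbitrarily small balls of mass close to (radius)^a
contain a dense G_delta of ]0, 1[ because values near a are attained
densely; Baire's theorem gives a point of local dimension at most a
([infimum_value]).

For a < b <= 1 ([intermediate_value]) assume that b is not a value, and call
a point tame when its balls satisfy m(x, r) <= C r^b for small r, where
m(x, r) is the mass of the ball of center x and radius r. Its local dimension
is then at least b, hence larger than b, so that m(x, r) <= r^b for even
smaller r: the constant resets to 1 by itself. Close to x there is a point z
of local dimension less than b, whose tiny balls have mass much larger than
r^b. As the radius decreases from the distance to x, the balls around z go
from light to heavy; stop at essentially the first radius s at which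
m(z, s) >= 2 s^b. At this scale the mass is comparable to s^b, and at larger
scales it is bounded by a constant times r^b. The weak-type maximal
inequality ([maximal_point]) then provides a point x' within s of z which is
tame below the scale s with an absolute constant, and the step
([next_ball]) can be repeated around x'. The nested balls shrink to a point y
with m(y, r) <= 1575 r^b for all small r, and m(y, 3s) >= 2 s^b for
arbitrarily small s. Its local dimension is b: a contradiction. *)

(** * Local dimension and power bounds on the mass of balls *)

Section BallMass.
Variable R : realType.
Variable mu : {finite_measure set (measurableTypeR R) -> \bar R}.
Implicit Types (x y z r s b c C : R).

Definition ball_mass x r : R := fine (mu (ball x r)).

Lemma ball_massE x r : (ball_mass x r)%:E = mu (ball x r).
Proof. by rewrite /ball_mass fineK//; apply: fin_num_measure; exact: measurable_ball. Qed.

Lemma ball_mass_ge0 x r : 0 <= ball_mass x r.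
Proof. exact: fine_ge0. Qed.

Lemma sub_ball x y r s : `|y - x| + r <= s -> ball x r `<=` (ball y s : set R).
Proof.
move=> h z; rewrite /ball/= => xz; apply: lt_le_trans h.
by rewrite -(subrKA x) (le_lt_trans (ler_normD _ _))// ltrD2l.
Qed.

Lemma le_ball_mass x y r s : `|y - x| + r <= s -> ball_mass x r <= ball_mass y s.
Proof.
move=> h; rewrite -lee_fin !ball_massE; apply: le_measure; rewrite ?inE.
- exact: measurable_ball.
- exact: measurable_ball.
- exact: sub_ball.
Qed.

Lemma ball_mass_supp_gt0 x r : 0 < r -> supp mu x -> 0 < ball_mass x r.
Proof.
move=> r0 sx; rewrite lt_neqAle ball_mass_ge0 andbT eq_sym; apply/eqP => m0.
have : (~` (ball x r : set R)) x.
  apply: (sx); split; first by apply: open_closedC; exact: ball_open.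
  by rewrite setCK -ball_massE m0.
by apply; exact: ballxx.
Qed.

Lemma ball_mass_notin_supp x : ~ supp mu x ->
  exists2 rho, 0 < rho & forall r, r < rho -> ball_mass x r = 0.
Proof.
move=> /existsNP[F] /not_implyP[[cF muF0] Fx].
have /nbhs_ballP[rho /= rho0 sub] : nbhs x (~` F).
  by apply: open_nbhs_nbhs; split => //; exact: closed_openC.
exists rho => // r rrho; rewrite /ball_mass.
suff -> : mu (ball x r) = 0%E by [].
apply: (@subset_measure0 _ _ _ mu _ (~` F)) => //.
- exact: measurable_ball.
- by apply: measurableC; exact: closed_measurable.
- by apply: subset_trans sub; apply: le_ball; exact: ltW.
Qed.


Lemma near_right0P (P : R -> Prop) :
  (\forall r \near 0^'+, P r) <->
  exists2 rho, 0 < rho & forall r, 0 < r < rho -> P r.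
Proof.
split.
  rewrite near_withinE => /nbhs_ballP[rho /= rho0 sub].
  exists rho => // r /andP[r0 rrho]; apply: sub => //.
  by rewrite /ball/= sub0r normrN gtr0_norm.
move=> [rho rho0 hP]; near=> r; apply: hP; apply/andP; split.
  by near: r; exact: nbhs_right_gt.
by near: r; exact: nbhs_right_lt.
Unshelve. all: by end_near. Qed.

(** A lower bound on the lower local dimension gains an arbitrary constant:
with b < g < [local_dim mu x], the mass is at most r^g = r^(g - b) r^b. *)
Lemma local_dim_gt x b c : (b%:E < local_dim mu x)%E -> 0 < c ->
  \forall r \near 0^'+, ball_mass x r < c * r `^ b.
Proof.
move=> + c0; rewrite /local_dim; case: ifPn => [_|/negP].
  rewrite limf_einfE => /ereal_sup_gt[_ /= [V nV <-]] blt.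
  have [g bg gV] : exists2 g, b < g & (g%:E <= ereal_inf
      [set (ln (fine (mu (ball x r))) / ln r)%:E | r in V])%E.
    move: blt; case: (ereal_inf _) => [e| |] //; first by rewrite lte_fin; exists e.
    by move=> _; exists (b + 1); rewrite ?ltrDl// leey.
  near=> r.
  have r0 : 0 < r by near: r; exact: nbhs_right_gt.
  have r1 : r < 1 by near: r; exact: nbhs_right_lt.
  have rV : V r by near: r.
  have rc : r `^ (g - b) < c.
    by near: r; apply: cvgr_lt c0; apply: powR_cvg0; rewrite subr_gt0.
  have [m0|m0] := leP (ball_mass x r) 0.
    by apply: le_lt_trans m0 _; rewrite mulr_gt0// powR_gt0.
  apply: (@le_lt_trans _ _ (r `^ g)).
    rewrite -ler_ln ?posrE ?powR_gt0// ln_powR -ler_ndivlMr ?ln_lt0 ?r0//.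
    rewrite -lee_fin; apply: le_trans gV _; apply: ereal_inf_lbound.
    by exists r.
  rewrite -(subrK b g) powRD; last by rewrite (gt_eqF r0) implybT.
  by rewrite ltr_pM2r// powR_gt0.
move=> xs _; have [rho rho0 m0] : exists2 rho, 0 < rho &
    forall r, r < rho -> ball_mass x r = 0.
  by apply: ball_mass_notin_supp => /mem_set.
apply/near_right0P; exists rho => // r /andP[r0 /m0 ->].
by rewrite mulr_gt0// powR_gt0.
Unshelve. all: by end_near. Qed.

(** A constant factor is absorbed by any loss e in the exponent, since C r^e
tends to 0. *)
Lemma local_dim_ge x b C :
  (\forall r \near 0^'+, ball_mass x r <= C * r `^ b) ->
  (b%:E <= local_dim mu x)%E.
Proof.
move=> hC; rewrite /local_dim; case: ifPn => [/set_mem xs|_]; last exact: leey.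
apply/lee_subgt0Pr => e e0; rewrite -EFinB limf_einfE.
have /near_right0P[rho rho0 hrho] :
    \forall r \near 0^'+, r < 1 /\ ball_mass x r <= r `^ (b - e).
  near=> r.
  have r0 : 0 < r by near: r; exact: nbhs_right_gt.
  have small : 0 < C -> r `^ e <= C^-1.
    near: r; have [C0|C0] := ltP 0 C; last by near=> r.
    have C1 : 0 < C^-1 by rewrite invr_gt0.
    by near=> r => _; near: r; apply: cvgr_le C1; exact: powR_cvg0.
  split; first by near: r; exact: nbhs_right_lt.
  have le1 : C * r `^ e <= 1.
    have [C0|C0] := leP C 0.
      by apply: (@le_trans _ _ 0) => //; rewrite mulr_le0_ge0// powR_ge0.
    by rewrite mulrC -ler_pdivlMr// div1r small.
  have : ball_mass x r <= C * r `^ b by near: r.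
  move/le_trans; apply.
  have -> : r `^ b = r `^ (b - e) * r `^ e.
    by rewrite -powRD ?subrK// (gt_eqF r0) implybT.
  by rewrite mulrCA ler_piMr// powR_ge0.
have nV : (0:R)^'+ [set r | 0 < r < rho] by apply/near_right0P; exists rho.
apply: (@le_trans _ _ (ereal_inf [set (ln (fine (mu (ball x r))) / ln r)%:E |
    r in [set r | 0 < r < rho]])); last by apply: ereal_sup_ubound; exists [set r | 0 < r < rho].
apply: le_ereal_inf_tmp => _ [r /= rrho <-].
have [r1 mr] := hrho _ rrho; have /andP[r0 _] := rrho.
rewrite lee_fin ler_ndivlMr ?ln_lt0 ?r0// -ln_powR ler_ln ?posrE ?powR_gt0//.
exact: ball_mass_supp_gt0.
Unshelve. all: by end_near. Qed.

End BallMass.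

(** * Vitali coverings *)

(** Extract from the balls a finite cover of K, then a disjoint subfamily whose
threefold dilations still cover K. Keeping two arbitrary measures covers both
uses: Lebesgue measure against [mu] yields a weak-type maximal inequality,
and [mu] against Lebesgue measure yields a density theorem. *)
Lemma vitali_comparison (R : realType)
    (M1 M2 : {measure set (measurableTypeR R) -> \bar R})
    (K U : set R) (t : R) :
  0 <= t -> compact K -> measurable U ->
  (forall x, K x -> exists r, [/\ 0 < r, ball x r `<=` U &
     (M1 (ball x (3 * r)) <= t%:E * M2 (ball x r))%E]) ->
  (M1 K <= t%:E * M2 U)%E.
Proof.
move=> t0 cK mU hK.
have /choice[r hr] : forall x, exists r, K x -> [/\ 0 < r, ball x r `<=` U &
    (M1 (ball x (3 * r)) <= t%:E * M2 (ball x r))%E].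
  by move=> x; have [/hK[r ?]|nKx] := pselect (K x); [exists r|exists 0].
pose B x : set R := ball x (if x \in K then r x else 1).
have Bpos x : 0 < (if x \in K then r x else 1).
  by case: ifPn => // /set_mem /hr[].
have Kcov : K `<=` cover K B by move=> x Kx; exists x => //; exact: ballxx.
have [F FK KF] : finite_subset_cover K B K.
  move: cK; rewrite compact_cover => /(_ _ _ _ _ Kcov); apply.
  by move=> x _; exact: ball_open.
have is_ballB x : is_ball (B x) by exact: is_ball_ball.
have B0 x : B x !=set0 by exists x; exact: ballxx.
have [E [uE EF tEB DE]] :=
  @vitali_lemma_finite_cover _ _ B is_ballB B0 (finmap.enum_fset F).
have EK x : x \in E -> K x by move=> /EF /FK /set_mem.
have mB x : measurable (B x) by exact: measurable_ball.
have m3B x : measurable (3 *` B x).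
  by rewrite scale_ballE//; exact: measurable_ball.
apply: (@le_trans _ _ (\sum_(x <- E) M1 (3 *` B x))%E).
  rewrite (big_nth 0) big_mkord.
  apply: (@content_subadditive _ _ _ M1 K (fun i => 3 *` B (nth 0 E i))).
  - by move=> k _; exact: m3B.
  - exact: compact_measurable.
  apply: (subset_trans (subset_trans KF DE)).
  by rewrite /cover bigcup_seq (big_nth 0) big_mkord.
apply: (@le_trans _ _ (\sum_(x <- E) t%:E * M2 (B x))%E).
  rewrite big_seq [in leRHS]big_seq; apply: lee_sum => x /EK Kx.
  rewrite scale_ballE// /B mem_set//.
  by have [] := hr _ Kx.
rewrite -ge0_sume_distrr//.
apply: lee_pmul => //.
  by apply: sume_ge0 => *; exact: measure_ge0.
have -> : (\sum_(x <- E) M2 (B x) = M2 (\big[setU/set0]_(x <- E) B x))%E.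
  rewrite fsbig_seq// -bigcup_seq measure_fin_bigcup => // i _; exact: mB.
apply: le_measure; [|exact/mem_set|].
  by apply/mem_set/bigsetU_measurable => i _; exact: mB.
rewrite -bigcup_seq => y [x /= /EK Kx]; rewrite /B mem_set//.
by have [_ + _] := hr _ Kx; apply.
Qed.

Section Consequences.
Variable R : realType.
Variable mu : {finite_measure set (measurableTypeR R) -> \bar R}.
Implicit Types (x y z r s b c C : R).

(** A weak-type maximal inequality: if every point of [c - rho, c + rho] had a
ball with m(x, r) > C r^b, then r <= rho^(1 - b) r^b, which uses b <= 1, would
bound the lengths of these balls by their masses, and the covering lemma
would give 2 rho <= 6 rho^(1 - b) m(c, 2 rho) / C. *)
Lemma maximal_point b C c rho : b <= 1 -> 0 < C -> 0 < rho ->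
  3 * ball_mass mu c (2 * rho) < C * rho `^ b ->
  exists2 x, `|c - x| <= rho &
    forall r, 0 < r <= rho -> ball_mass mu x r <= C * r `^ b.
Proof.
move=> b1 C0 rho0; rewrite ltNge => /negP small; apply: contrapT => noX.
apply: small.
pose t := 6 * rho `^ (1 - b) / C.
have t0 : 0 <= t by rewrite /t divr_ge0 ?mulr_ge0 ?powR_ge0// ltW.
have powE s : 0 < s -> s = s `^ (1 - b) * s `^ b.
  by move=> s0; rewrite -powRD ?subrK ?powRr1// ?(gt_eqF s0) ?implybT// ltW.
have : (lebesgue_measure `[(c - rho)%R, (c + rho)%R]%classic <=
    t%:E * mu (ball c (2 * rho)))%E.
  apply: vitali_comparison => //.
  - exact: segment_compact.
  - exact: measurable_ball.
  move=> x /=; rewrite in_itv/= => xK.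
  have cx : `|c - x| <= rho by rewrite distrC ler_distl.
  have [r [/andP[r0 rr] /negP]] : exists r, 0 < r <= rho /\
      ~ ball_mass mu x r <= C * r `^ b.
    apply: contrapT => nr; apply: noX; exists x => // r rr.
    by apply: contrapT => h; apply: nr; exists r.
  rewrite -ltNge => big; exists r; split=> //.
    by apply: sub_ball; rewrite mulr_natl mulr2n lerD.
  rewrite lebesgue_measure_ball; last by rewrite mulr_ge0// ltW.
  rewrite -ball_massE -EFinM lee_fin.
  have h1 : r `^ (1 - b) <= rho `^ (1 - b).
    by rewrite ge0_ler_powR ?subr_ge0 ?nnegrE// ltW.
  have h2 : r `^ (1 - b) * (C * r `^ b) <= rho `^ (1 - b) * ball_mass mu x r.
    by apply: ler_pM (ltW big) => //; rewrite ?powR_ge0// mulr_ge0 ?powR_ge0// ltW.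
  have h3 : C * r <= rho `^ (1 - b) * ball_mass mu x r.
    by apply: le_trans h2; rewrite mulrCA -powE.
  have -> : t * ball_mass mu x r = (6 / C) * (rho `^ (1 - b) * ball_mass mu x r).
    by rewrite /t; ring.
  have -> : (3 * r) *+ 2 = (6 / C) * (C * r).
    by rewrite mulrA divfK ?gt_eqF//; ring.
  by rewrite ler_wpM2l// divr_ge0// ltW.
rewrite lebesgue_measure_itv/= lte_fin ifT; last by lra.
rewrite -ball_massE -EFinB -EFinM lee_fin.
have -> : c + rho - (c - rho) = 2 * rho by ring.
rewrite /t {1}(powE _ rho0) => h.
have p0 := powR_gt0 (1 - b) rho0.
rewrite -(@ler_pM2l _ (2 * rho `^ (1 - b) / C)); last first.
  by rewrite divr_gt0// mulr_gt0.
have -> : 2 * rho `^ (1 - b) / C * (C * rho `^ b) =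
    2 * (rho `^ (1 - b) * rho `^ b).
  by field; rewrite gt_eqF.
by apply: le_trans h _; rewrite le_eqVlt; apply/orP; left; apply/eqP; ring.
Qed.

(** Otherwise each interval [-n, n] is covered by balls of mass at most t times
their length, for every t > 0, hence is null. *)
Lemma exists_local_dim_le1 : mu setT <> 0%E ->
  exists x, (local_dim mu x <= 1%:E)%E.
Proof.
move=> mu0; apply: contrapT => noX; apply: mu0.
have gt1 x : (1%:E < local_dim mu x)%E.
  by rewrite ltNge; apply/negP => h; apply: noX; exists x.
have null n : mu `[- n%:R, n%:R]%classic = 0%E.
  apply/eqP; rewrite eq_le measure_ge0 andbT; apply/lee_addgt0Pr => e e0.
  rewrite add0e.
  pose N : R := n.+1%:R *+ 2.
  have N0 : 0 < N by rewrite mulrn_wgt0// ltr0n.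
  have -> : e%:E = ((e / N)%:E * lebesgue_measure (ball (0%R:R) (n.+1%:R)%R : set R))%E.
    by rewrite lebesgue_measure_ball// -EFinM divfK ?gt_eqF.
  have t0 : 0 < e / N by rewrite divr_gt0.
  apply: vitali_comparison; [exact: ltW|exact: segment_compact|exact: measurable_ball|].
  move=> x /=; rewrite in_itv/= => xn.
  have /local_dim_gt/(_ (mulr_gt0 t0 (_ : 0 < 2 / 3))) := gt1 x.
  move=> /(_ ltac:(lra)) /near_right0P[rho rho0 hrho].
  pose r := Num.min 1 (rho / 4).
  have r0 : 0 < r by rewrite lt_min ltr01 divr_gt0.
  have r1 : r <= 1 by rewrite ge_min lexx.
  have rrho : r <= rho / 4 by rewrite ge_min lexx orbT.
  exists r; split => //.
    apply: sub_ball; rewrite sub0r normrN.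
    have : `|x| <= n%:R by rewrite ler_norml.
    by rewrite -natr1; lra.
  rewrite lebesgue_measure_ball ?(ltW r0)// -ball_massE -EFinM lee_fin.
  have /ltW : ball_mass mu x (3 * r) < e / N * (2 / 3) * (3 * r) `^ 1.
    by apply: hrho; apply/andP; split; lra.
  rewrite powRr1; last by lra.
  move/le_trans; apply; move: (e / N) => q.
  by rewrite mulr2n; lra.
apply/(negligibleP mu measurableT).
apply: (@negligibleS _ _ _ mu (\bigcup_n `[- n%:R, n%:R]%classic)).
  move=> x _; exists (Num.Def.archi_bound `|x|) => //=.
  by rewrite in_itv/= -ler_norml ltW// archi_boundP.
by apply: negligible_bigcup => n; apply/(negligibleP mu (measurable_itv _)); exact: null.
Qed.

End Consequences.

(** * The shrinking construction *)

Lemma nested_intervals (R : realType) (x rho : nat -> R) :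
  (forall n, 0 < rho n) ->
  (forall n, `|x n - x n.+1| + rho n.+1 <= rho n) ->
  exists y, forall n, `|x n - y| <= rho n.
Proof.
move=> rho0 nest.
have sub n m : `|x n - x (n + m)%N| + rho (n + m)%N <= rho n.
  elim: m => [|m IH]; first by rewrite addn0 subrr normr0 add0r.
  apply: le_trans IH; rewrite addnS.
  have := nest (n + m)%N; have := ler_distD (x (n + m)%N) (x n) (x (n + m).+1).
  lra.
have lu m n : x m - rho m <= x n + rho n.
  wlog: m n / (m <= n)%N => [hw|mn].
    have [/hw//|/ltnW nm] := leqP m n; have := sub n (m - n)%N.
    have := rho0 m; have := ler_norm (x n - x m); have := ler_norm (x m - x n).
    by rewrite subnKC// [`|x m - x n|]distrC; lra.
  have := sub m (n - m)%N; have := rho0 n; have := ler_norm (x m - x n).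
  by rewrite subnKC//; lra.
pose L := [set x n - rho n | n in [set: nat]].
have L0 : L !=set0 by exists (x 0%N - rho 0%N), 0%N.
exists (sup L) => n; rewrite distrC ler_distl; apply/andP; split.
  apply: ub_le_sup; last by exists n.
  by exists (x 0%N + rho 0%N) => _ [m _ <-]; exact: lu.
by apply: ge_sup => // _ [m _ <-]; exact: lu.
Qed.

Section Construction.
Variable R : realType.
Variable mu : {finite_measure set (measurableTypeR R) -> \bar R}.
Variable b : R.
Hypothesis b01 : 0 <= b <= 1.
Implicit Types (x y z r s c C rho k : R).
Let b_ge0 : 0 <= b. Proof. by case/andP: b01. Qed.
Let b_le1 : b <= 1. Proof. by case/andP: b01. Qed.

Lemma powR_scale k s : 1 <= k -> 0 <= s -> (k * s) `^ b <= k * s `^ b.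
Proof.
move=> k1 s0; rewrite powRM//; last by lra.
by rewrite ler_wpM2r ?powR_ge0// ler1_powR.
Qed.

Lemma powR_le_scale k r s : 1 <= k -> 0 <= r -> r <= k * s -> 0 <= s ->
  r `^ b <= k * s `^ b.
Proof.
move=> k1 r0 rks s0; apply: le_trans (powR_scale k1 s0).
by rewrite ge0_ler_powR// nnegrE// (le_trans r0).
Qed.

Definition controlled C x rho := forall r, 0 < r <= rho -> ball_mass mu x r <= C * r `^ b.

Lemma controlled_local_dim C x rho : 0 < rho -> controlled C x rho ->
  (b%:E <= local_dim mu x)%E.
Proof.
move=> rho0 ctl; apply: (@local_dim_ge _ _ _ _ C).
by apply/near_right0P; exists rho => // r /andP[r0 /ltW rr]; apply: ctl; rewrite r0.
Qed.

Hypothesis not_value : forall x, local_dim mu x <> b%:E.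

(** The self-improvement that keeps the constants from accumulating along the
construction: a point with a bound C r^b has local dimension at least b, hence
larger than b, so that [local_dim_gt] applies with constant 1. *)
Lemma controlled_improve C x rho : 0 < rho -> controlled C x rho ->
  exists2 rho1, 0 < rho1 & controlled 1 x rho1.
Proof.
move=> rho0 /(controlled_local_dim rho0) ge_b.
have : (b%:E < local_dim mu x)%E.
  by rewrite lt_neqAle ge_b andbT eq_sym; exact/eqP/not_value.
move=> /local_dim_gt/(_ ltr01)/near_right0P[eta eta0 heta].
exists (eta / 2); first by lra.
by move=> r /andP[r0 rr]; apply/ltW/heta; rewrite r0/=; lra.
Qed.

(** One step of the construction. All points y of the new ball inherit the
power bound at the scales between the new radius and the old one, and see a
ball of mass comparable to the b-th power of the new radius; so the limit of
the nested balls inherits both facts at every step. The constants only need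
to be independent of the step: 25 exceeds 3 * 8, where 8 bounds
m(z, 2 s0) / s0^b; and 1575 = 75 * 21, because a ball of radius r >= s0 / 10
around y lies in the ball of radius r + 2 s0 <= 21 r around z, whose mass is at
most 75 (21 r)^b. *)
Lemma next_ball x rho : 0 < rho -> controlled 25 x rho ->
  (forall d, 0 < d -> exists2 z, `|x - z| < d & (local_dim mu z < b%:E)%E) ->
  exists x' rho', [/\ 0 < rho', rho' <= rho / 20, `|x - x'| + rho' <= rho,
    controlled 25 x' rho' &
    forall y, `|x' - y| <= rho' ->
      2 * rho' `^ b <= ball_mass mu y (3 * rho') /\
      (forall r, rho' / 10 <= r <= rho / 10 -> ball_mass mu y r <= 1575 * r `^ b)].
Proof.
move=> rho0 ctl dense.
have [rho1 rho10 ctl1] := controlled_improve rho0 ctl.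
pose d := Num.min (rho / 20) (rho1 / 10).
have d0 : 0 < d by rewrite lt_min; apply/andP; split; lra.
have drho : d <= rho / 20 by rewrite ge_min lexx.
have drho1 : d <= rho1 / 10 by rewrite ge_min lexx orbT.
have [z xz hz] := dense d d0.
pose S := [set s | 0 < s <= d /\ 2 * s `^ b <= ball_mass mu z s].
have [s1 [/andP[s10 s1d] s1S]] : exists s, S s.
  apply: contrapT => noS; move: hz; rewrite ltNge => /negP; apply.
  apply: (@controlled_local_dim 2 z d d0) => r rd.
  by rewrite leNgt; apply/negP => /ltW h; apply: noS; exists r.
have Sub : has_ubound S by exists d => s [/andP[]].
have hS : has_sup S by split=> //; exists s1; split=> //; rewrite s10.
have s1sup : s1 <= sup S by apply: ub_le_sup => //; split=> //; rewrite s10.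
(* S may not contain its supremum; an element above half of it suffices, for
   then no radius in [2 s0, d] belongs to S. *)
have [s0 [/andP[s00 s0d] s0S] s0sup] : exists2 s0, S s0 & sup S - sup S / 2 < s0.
  by apply: sup_adherent => //; lra.
have above s : 2 * s0 <= s -> s <= d -> ball_mass mu z s < 2 * s `^ b.
  move=> ss0 sd; rewrite ltNge; apply/negP => h.
  have : s <= sup S by apply: ub_le_sup => //; split=> //; apply/andP; split; lra.
  by lra.
have zx s : d <= 2 * s -> ball_mass mu z s <= ball_mass mu x (3 * s).
  by move=> ds; apply: le_ball_mass; lra.
have fine_bound s : s0 <= s -> 3 * s <= rho1 -> ball_mass mu z s <= 4 * s `^ b.
  move=> ss0 srho1; have s_ge0 : 0 <= s by lra.
  have p0 := powR_ge0 s b.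
  have [sd|ds] := leP (2 * s) d.
    apply: (@le_trans _ _ (ball_mass mu z (2 * s))).
      by apply: le_ball_mass; rewrite subrr normr0; lra.
    have := @powR_scale 2 s; have := above (2 * s).
    by move=> /(_ ltac:(lra) sd) h1 /(_ ltac:(lra) s_ge0); lra.
  apply: le_trans (zx s (ltW ds)) _.
  have := @powR_scale 3 s => /(_ ltac:(lra) s_ge0).
  have := ctl1 (3 * s) => /(_ ltac:(apply/andP; split; lra)).
  by lra.
have coarse_bound s : s0 <= s -> 3 * s <= rho -> ball_mass mu z s <= 75 * s `^ b.
  move=> ss0 srho; have s_ge0 : 0 <= s by lra.
  have p0 := powR_ge0 s b.
  have [/(fine_bound s ss0)|s_big] := leP (3 * s) rho1; first by lra.
  apply: le_trans (zx s _) _; first by lra.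
  have := @powR_scale 3 s => /(_ ltac:(lra) s_ge0).
  have := ctl (3 * s) => /(_ ltac:(apply/andP; split; lra)).
  by lra.
have [x' zx' ctl'] : exists2 x', `|z - x'| <= s0 & controlled 25 x' s0.
  apply: maximal_point => //.
  have := fine_bound (2 * s0) => /(_ ltac:(lra) ltac:(lra)).
  have := @powR_scale 2 s0 => /(_ ltac:(lra) (ltW s00)).
  by have := powR_gt0 b s00; lra.
exists x', s0; split=> //; first by lra.
  by have := ler_distD z x x'; lra.
move=> y x'y; have zy : `|z - y| <= 2 * s0 by have := ler_distD x' z y; lra.
split.
  by apply: le_trans s0S _; apply: le_ball_mass; rewrite distrC; lra.
move=> r /andP[s0r rrho].
apply: (@le_trans _ _ (ball_mass mu z (r + 2 * s0))).
  by apply: le_ball_mass; lra.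
have := @powR_le_scale 21 (r + 2 * s0) r.
move=> /(_ ltac:(lra) ltac:(lra) ltac:(lra) ltac:(lra)).
have := coarse_bound (r + 2 * s0) => /(_ ltac:(lra) ltac:(lra)).
by lra.
Qed.

End Construction.

(** If b is not a value, iterating [next_ball] yields a point of local dimension
exactly b. *)
Lemma intermediate_value (R : realType)
    (mu : {finite_measure set (measurableTypeR R) -> \bar R}) (b : R) :
  0 <= b <= 1 ->
  (forall x d, 0 < x < 1 -> 0 < d ->
     exists2 z, `|x - z| < d & (local_dim mu z < b%:E)%E) ->
  exists x, local_dim mu x = b%:E.
Proof.
move=> b01 dense; apply: contrapT => noX.
have nv x : local_dim mu x <> b%:E by move=> h; apply: noX; exists x.
have /andP[b0 b1] := b01.
pose Inv (p : R * R) := [/\ 0 < p.2, 0 < p.1 - p.2, p.1 + p.2 < 1 &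
  controlled mu b 25 p.1 p.2].
pose Step (p q : R * R) := [/\ 0 < q.2, q.2 <= p.2 / 20, `|p.1 - q.1| + q.2 <= p.2,
    controlled mu b 25 q.1 q.2 &
    forall y, `|q.1 - y| <= q.2 ->
      2 * q.2 `^ b <= ball_mass mu y (3 * q.2) /\
      (forall r, q.2 / 10 <= r <= p.2 / 10 -> ball_mass mu y r <= 1575 * r `^ b)].
have /choice[f hf] : forall p, exists q, Inv p -> Step p q.
  move=> [x rho]; have [[/= r0 x0 x1 ctl]|ni] := pselect (Inv (x, rho)); last by exists (x, rho).
  have [x' [rho' h]] := next_ball b01 nv r0 ctl
    (fun d => dense x d (ltac:(apply/andP; split; lra))).
  by exists (x', rho').
(* Any constant will do for the first ball, thanks to [controlled_improve]. *)
have [p0 Ip0] : exists p, Inv p.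
  pose m := ball_mass mu (1 / 2) (2 * (1 / 4)).
  pose q := (1 / 4 : R) `^ b.
  have q0 : 0 < q by rewrite powR_gt0//; lra.
  have m0 : 0 <= m by exact: ball_mass_ge0.
  have C0 : 0 < 3 * m / q + 1.
    by rewrite ltr_wpDl// divr_ge0 ?mulr_ge0// ltW.
  have [||x0 hx0 ctl] := @maximal_point _ mu b (3 * m / q + 1) (1 / 2) (1 / 4) b1 C0.
  - by lra.
  - rewrite -/m -/q.
    have -> : (3 * m / q + 1) * q = 3 * m + q by field; rewrite gt_eqF.
    by lra.
  have [|rho1 rho10 ctl1] := controlled_improve nv _ ctl; first by lra.
  pose rho := Num.min (1 / 8) rho1.
  have rho0 : 0 < rho by rewrite lt_min rho10 andbT; lra.
  have rho8 : rho <= 1 / 8 by rewrite ge_min lexx.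
  have rho_1 : rho <= rho1 by rewrite ge_min lexx orbT.
  move: hx0; rewrite distrC ler_distl => /andP[xl xu].
  exists (x0, rho); split=> //=; [lra|lra|].
  move=> r /andP[r0 rr].
  have : ball_mass mu x0 r <= 1 * r `^ b by apply: ctl1; rewrite r0 (le_trans rr).
  by have := powR_ge0 r b; lra.
pose p n := iter n f p0.
have Ip n : Inv (p n).
  elim: n => [//|n [p20 pl pu ctl]]; have [q0 _ nest ctl' _] := hf _ (And4 p20 pl pu ctl).
  split=> //=.
    by have := ler_norm ((p n).1 - (f (p n)).1); rewrite -/(p n); lra.
  have := ler_norm ((f (p n)).1 - (p n).1); rewrite distrC -/(p n); lra.
have Sp n : Step (p n) (p n.+1) := hf _ (Ip n).
have p2 n : 0 < (p n).2 by case: (Ip n).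
have [y hy] := @nested_intervals _ (fun n => (p n).1) (fun n => (p n).2) p2
  (fun n => let: And5 _ _ h _ _ := Sp n in h).
have small eta : 0 < eta -> exists n, (p n).2 < eta.
  move=> eta0.
  have bound n : (p n).2 * n.+1%:R <= (p 0%N).2.
    elim: n => [|n IH]; first by rewrite mulr1.
    apply: le_trans IH; have [_ h _ _ _] := Sp n.
    rewrite -!natr1; have n0 := ler0n R n; have := p2 n; nra.
  exists (Num.Def.archi_bound ((p 0%N).2 / eta)).
  set N := Num.Def.archi_bound _.
  have hN : (p 0%N).2 / eta < N%:R by apply: archi_boundP; rewrite divr_ge0// ltW.
  rewrite ltr_pdivrMr// in hN.
  have := bound N; rewrite -natr1; have := ler0n R N; have := p2 N.
  rewrite ltNge => h1 h2 h3; apply/negP => h4; nra.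
apply: (nv y); apply/eqP; rewrite eq_le; apply/andP; split; last first.
  have p00 := p2 0%N.
  apply: (@controlled_local_dim _ mu b 1575 y ((p 0%N).2 / 10)); first by lra.
  move=> r /andP[r0 rr].
  (* Locate the step at which the radius passes below 10 r. *)
  have ex : exists n, (p n.+1).2 / 10 <= r.
    have [|n hn] := small (10 * r); first by lra.
    exists n; have [_ h _ _ _] := Sp n; have := p2 n; lra.
  have [n hn min_n] := ex_minnP ex.
  have [_ _ _ _ /(_ y (hy n.+1))[_]] := Sp n; apply.
  rewrite hn/=; case: n min_n {hn} => // n min_n.
  by rewrite leNgt; apply/negP => /ltW /min_n; rewrite ltnn.
rewrite leNgt; apply/negP => /local_dim_gt/(_ (ltac:(lra) : 0 < 2 / 3 :> R)).
move=> /near_right0P[eta eta0 heta].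
have [n hn] := small eta eta0.
have [_ h _ _ /(_ y (hy n.+1))[low _]] := Sp n.
have q0 := p2 n.+1.
have := @powR_scale _ b b01 3 (p n.+1).2 => /(_ ltac:(lra) (ltW q0)).
have := heta (3 * (p n.+1).2) => /(_ ltac:(apply/andP; split; have := p2 n; lra)).
by lra.
Qed.

(** * The set of values of the local dimension *)

Lemma hausdorff_dim_ge0 (R : realType) (A : set R) :
  (0 <= hausdorff_dim A)%E <-> A !=set0.
Proof.
rewrite /hausdorff_dim; case: eqP => [->|/eqP/set0P A0].
  by split=> [|[x []]]//; rewrite leeNy_eq.
split=> // _; apply: le_ereal_inf_tmp => _ [s [s0 _] <-].
by rewrite lee_fin.
Qed.

Section Values.
Variable R : realType.
Variable mu : {finite_measure set (measurableTypeR R) -> \bar R}.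
Implicit Types (x y z r s v d e : R).

Definition values : set R := [set v | exists x, local_dim mu x = v%:E].

Lemma local_dim_ge0 x : (0%:E <= local_dim mu x)%E.
Proof.
apply: (@local_dim_ge _ _ _ _ (fine (mu setT))).
apply/near_right0P; exists 1 => // r _; rewrite powRr0 mulr1.
rewrite -lee_fin ball_massE fineK; last exact: fin_num_measure.
by apply: le_measure; rewrite ?inE//; exact: measurable_ball.
Qed.

Lemma local_dim_le_values x v : (local_dim mu x <= v%:E)%E ->
  exists2 w, values w & local_dim mu x = w%:E.
Proof.
have := local_dim_ge0 x; case E : (local_dim mu x) => [w| |] //.
by exists w => //; exists x.
Qed.

Lemma values_ge0 v : values v -> 0 <= v.
Proof. by move=> [x E]; have := local_dim_ge0 x; rewrite E lee_fin. Qed.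

Lemma local_dim_fin_supp x v : local_dim mu x = v%:E -> supp mu x.
Proof. by rewrite /local_dim; case: ifPn => // /set_mem. Qed.

Lemma local_dim_lt x v d : (local_dim mu x < v%:E)%E -> 0 < d ->
  exists2 s, 0 < s < d & s `^ v <= ball_mass mu x s.
Proof.
move=> + d0; rewrite ltNge => /negP small; apply: contrapT => noS; apply: small.
apply: (@local_dim_ge _ _ _ _ 1); apply/near_right0P; exists d => // s sd.
by rewrite mul1r leNgt; apply/negP => /ltW h; apply: noS; exists s.
Qed.

Definition densely_attained v := forall x d, 0 <= x < 1 -> 0 < d ->
  exists2 z, `|x - z| < d & local_dim mu z = v%:E.

(** Every point of ]0, 1[ that lies, for each n, in a ball of radius s < 1/(n+1)
and mass at least s^(a + 1/(n+1)) has local dimension at most a. For each n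
the union of these balls is open, and dense in [0, 1]. The complement of [0, 1] is added to each of these sets so
that Baire's theorem applies on the whole line. *)
Lemma infimum_value (a : R) :
  (forall v, values v -> a <= v) ->
  (forall e, 0 < e -> exists2 v, v < a + e & densely_attained v) ->
  values a.
Proof.
move=> lb approx.
pose q n : R := n.+1%:R^-1.
have q0 n : 0 < q n by rewrite invr_gt0.
pose D n := [set p : R * R | 0 < p.2 < q n /\ p.2 `^ (a + q n) <= ball_mass mu p.1 p.2].
pose O n : set R := ~` `[0, 1]%classic `|` \bigcup_(p in D n) ball p.1 p.2.
have openO n : open (O n).
  apply: openU; first by apply: closed_openC; exact: itv_closed.
  by apply: bigcup_open => p _; exact: ball_open.
have denseO n : dense (O n).
  move=> W [w Ww] oW.
  have [e /= e0 We] : exists2 e, 0 < e & ball w e `<=` W.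
    by have /nbhs_ballP[e ? ?] : nbhs w W by [exact: open_nbhs_nbhs]; exists e.
  have [w01|w01] := pselect (`[0, 1]%classic w); last by exists w; split => //; left.
  move: w01; rewrite /= in_itv/= => /andP[w0].
  rewrite le_eqVlt => /orP[/eqP w1|w1].
    exists (w + e / 2); split.
      apply: We; rewrite /ball/= opprD addrA subrr sub0r normrN gtr0_norm; lra.
    by left; rewrite /= in_itv/= => /andP[_]; lra.
  have [v va dv] := approx _ (q0 n).
  have [||z wz zv] := dv w e; [by rewrite w0|by []|].
  have [s sq sm] : exists2 s, 0 < s < q n & s `^ (a + q n) <= ball_mass mu z s.
    by apply: local_dim_lt => //; rewrite zv lte_fin.
  exists z; split; first exact: We.
  by right; exists (z, s) => //=; apply: ballxx; case/andP: sq.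
have [||x [/= x01 xO]] := Baire (fun n => conj (openO n) (denseO n)) (O := `]0, 1[%classic).
- by exists (1 / 2); rewrite /= in_itv/=; apply/andP; split; lra.
- exact: interval_open.
have : (local_dim mu x <= a%:E)%E.
  apply/lee_addgt0Pr => e e0; rewrite -EFinD leNgt; apply/negP.
  have c0 : 0 < ((2 : R) `^ (a + e))^-1 by rewrite invr_gt0 powR_gt0.
  move=> /local_dim_gt/(_ c0)/near_right0P[eta eta0 heta].
  pose m := Num.min (Num.min e (eta / 2)) 1.
  have m0 : 0 < m by rewrite !lt_min e0 ltr01 andbT/=; lra.
  have [n qm] : exists n, q n < m.
    exists (Num.Def.archi_bound m^-1); rewrite /q invf_plt ?posrE//.
    apply: lt_trans (archi_boundP _) _; last by rewrite ltr_nat.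
    by rewrite invr_ge0 ltW.
  have : [/\ q n < e, q n < eta / 2 & q n < 1].
    by move: qm; rewrite !lt_min => /andP[/andP[-> ->] ->].
  move=> [qe qeta q1].
  have [|[[z s] [/= /andP[s0 sq] sm] xz]] := xO n I.
    apply; move: x01; rewrite /= !in_itv/= => /andP[x0 x1].
    by rewrite !ltW.
  (* x lies in the ball of center z and radius s, so its own ball of radius
     2 s contains that heavy ball. *)
  have := heta (2 * s) => /(_ ltac:(apply/andP; split; lra)).
  apply/negP; rewrite -leNgt powRM//; last exact: ltW.
  rewrite mulKf ?gt_eqF ?powR_gt0//.
  apply: (@le_trans _ _ (s `^ (a + q n))).
    by rewrite ger_powR ?lerD2l ?(ltW qe)// s0/=; lra.
  apply: le_trans sm _; apply: le_ball_mass.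
  by move: xz; rewrite /ball/= distrC; lra.
move=> /[dup] /local_dim_le_values[w Vw Ew]; rewrite Ew lee_fin => wa.
by exists x; rewrite Ew; congr EFin; apply/eqP; rewrite eq_le wa lb.
Qed.

(** Nonnegativity of the Hausdorff dimension says that a set is nonempty, so
homogeneity transfers the existence of a point in a level set to every
subinterval. *)
Lemma homogeneous_values_dense v : homogeneously_multifractal mu ->
  values v -> densely_attained v.
Proof.
move=> [s01 hm] [x0 Ex0] x d /andP[x_ge0 x1] d0.
have v0 : 0 <= v by apply: values_ge0; exists x0.
pose y := Num.min ((x + 1) / 2) (x + d / 2).
have xy : x < y by rewrite lt_min; apply/andP; split; lra.
have y1 : y <= (x + 1) / 2 by rewrite ge_min lexx.
have yd : y <= x + d / 2 by rewrite ge_min lexx orbT.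
have [z [/=]] : `[x, y]%classic `&` level_set mu v !=set0.
  apply/hausdorff_dim_ge0; rewrite hm //.
  - apply/hausdorff_dim_ge0; exists x0; split=> //; apply: s01.
    exact: local_dim_fin_supp Ex0.
  - split; first exact: interval_is_interval.
    by exists x, y; rewrite /= !in_itv/= !lexx ltW.
  - move=> z /=; rewrite !in_itv/= => /andP[xz zy]; apply/andP; split; lra.
rewrite in_itv/= => /andP[xz zy] zv; exists z => //.
by rewrite distrC ger0_norm; lra.
Qed.

Lemma spectrum_supportE : supp mu `<=` `[0, 1] -> spectrum_support mu = values.
Proof.
move=> s01; apply/seteqP; split=> v.
  by move=> [_ /hausdorff_dim_ge0[x [_ xv]]]; exists x.
move=> Vv; split; first exact: values_ge0.
have [x Ex] := Vv; apply/hausdorff_dim_ge0; exists x; split=> //.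
by apply: s01; exact: local_dim_fin_supp Ex.
Qed.

End Values.

Theorem theorem1p5 (R : realType)
    (mu : {finite_measure set (measurableTypeR R) -> \bar R})
    (mu_neq0 : mu setT <> 0%E)
    (mu_supp : supp mu `<=` `[0, 1])
    (mu_non_atomic : non_atomic mu)
    (mu_hm : homogeneously_multifractal mu) :
  exists alpha : R, 0 <= alpha <= 1 /\
    spectrum_support mu `&` `[0, 1] = `[alpha, 1]%classic.
Proof.
rewrite spectrum_supportE//; set V := values mu.
have V_ge0 v : V v -> 0 <= v by exact: values_ge0.
have [x0 /[dup] /local_dim_le_values[w Vw ->]] := exists_local_dim_le1 mu_neq0.
rewrite lee_fin => w1.
have lbV : has_lbound V by exists 0 => v /V_ge0.
have infV : has_inf V by split=> //; exists w.
have dense v : V v -> densely_attained mu v by exact: homogeneous_values_dense.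
have inf_lb v : V v -> inf V <= v by exact: ge_inf.
have approx e : 0 < e -> exists2 v, v < inf V + e & V v.
  by move=> e0; have [v] := inf_adherent e0 infV; exists v.
have inf0 : 0 <= inf V by apply: lb_le_inf => [|v /V_ge0]//; exists w.
exists (inf V); split; first by rewrite inf0 (le_trans (inf_lb _ Vw)).
apply/seteqP; split=> v /=; rewrite !in_itv/=.
  by move=> [Vv /andP[_ ->]]; rewrite inf_lb.
move=> /andP[av v1]; split; last by rewrite (le_trans inf0 av).
move: av; rewrite le_eqVlt => /orP[/eqP <-|av].
  apply: infimum_value => // e /approx[u ue Vu]; exists u => //; exact: dense.
apply: intermediate_value; first by rewrite (le_trans inf0 (ltW av)).
have [|u uv Vu] := approx (v - inf V); first by rewrite subr_gt0.
move=> x d /andP[x0' x1] d0; have [||z xz zu] := dense u Vu x d; rewrite ?(ltW x0')//.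
by exists z => //; rewrite zu lte_fin; lra.
Qed.
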